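(* Let $S_1, S_2 \subseteq \mathbb{R}$ be finite sets with $|S_1| = n$, $|S_2| = m$, and $0 \in S_1 \cap S_2$, and set $\Gamma = S_1 \times S_2 \subseteq \mathbb{R}^2$. If, for a positive integer $k$, we have $n \ge (k-1)(m-1) + 1$, then \[ \operatorname{cov}_k(\Gamma) = k(n-1) + (m-1). \]
   Context: For finite $S_1, S_2 \subseteq \mathbb{R}$ with $0 \in S_1 \cap S_2$, let $\Gamma = S_1 \times S_2$. For an integer $k \ge 1$, a $k$-cover of $\Gamma$ is a finite multiset $\mathcal{H}$ of (affine) lines in $\mathbb{R}^2$ such that every point of $\Gamma \setminus \{(0,0)\}$ is contained in at least $k$ of the lines (counted with multiplicity), while no line of $\mathcal{H}$ contains $(0,0)$. $\operatorname{cov}_k(\Gamma)$ denotes the minimum cardinality (counted with multiplicity) of a $k$-cover of $\Gamma$. *)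

(* Defs.v *)
From HB Require Import structures.
From mathcomp Require Import all_boot all_order all_algebra.
From mathcomp Require Import finmap multiset.
From mathcomp Require Import boolp classical_sets reals.

Set Implicit Arguments.
Unset Strict Implicit.
Unset Printing Implicit Defensive.

Import Order.TTheory GRing.Theory Num.Theory.

Local Open Scope ring_scope.
Local Open Scope mset_scope.

Definition is_line (R : realType) (L : set (R * R)) : Prop :=
  exists a b c : R, (a, b) != (0, 0) /\
    L = [set p | a * p.1 + b * p.2 = c]%classic.

Definition is_kcover (R : realType) (k : nat) (G : {fset R * R})
    (H : {mset set (R * R)}) : Prop :=
  [/\ forall L, L \in H -> is_line L,
      forall p, p \in G -> p != (0, 0) -> (k <= count (fun L => p \in L) H)%N
    & forall L, L \in H -> (0, 0) \notin L].

Lemma kcover_exists (R : realType) (k : nat) (G : {fset R * R}) :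
  exists N : nat, `[< exists H, is_kcover k G H /\ size H = N >].
Proof.
pose ln (p : R * R) := [set q | p.1 * q.1 + p.2 * q.2 = p.1 ^+ 2 + p.2 ^+ 2]%classic.
pose s := flatten [seq nseq k (ln p) | p <- G & p != (0, 0)].
have sP L : L \in seq_mset s -> exists2 p, p != (0, 0) & L = ln p.
  rewrite (perm_mem (perm_eq_seq_mset s)) => /flatten_mapP[p].
  rewrite mem_filter => /andP[p0 _]; rewrite mem_nseq => /andP[_ /eqP ->].
  by exists p.
exists (size (seq_mset s)); apply/asboolP; exists (seq_mset s); split => //; split.
- move=> L /sP[[a b] p0 ->]; exists a, b, (a ^+ 2 + b ^+ 2); by split.
- move=> p pG p0; rewrite (permP (perm_eq_seq_mset s)).
  rewrite count_flatten -map_comp sumn_map big_filter.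
  rewrite (big_rem p) //= p0 count_nseq.
  have -> : p \in ln p by apply/mem_set; rewrite /ln /= !expr2.
  by rewrite mul1n leq_addr.
- move=> L /sP[[a b] p0 ->]; apply/negP => /set_mem /= /esym/eqP.
  rewrite !mulr0 addr0 paddr_eq0 ?sqr_ge0 // !sqrf_eq0 => ab0.
  by move: p0; rewrite xpair_eqE ab0.
Qed.

Definition cov (R : realType) (k : nat) (G : {fset R * R}) : nat :=
  ex_minn (kcover_exists k G).

(* Main.v *)
Require Import Defs.
From mathcomp Require Import all_boot all_order all_algebra.
From mathcomp Require Import finmap multiset boolp classical_sets reals.
From mathcomp Require Import zify ring.

Set Implicit Arguments.
Unset Strict Implicit.

Import GRing.Theory.

Local Open Scope ring_scope.

(** Upper bound: write [A] and [B] for the nonzero elements of [S1] and [S2].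
    Each point [(s, 0)] costs [k] lines of its own, since a line avoiding the
    origin meets the first axis at most once.  The hypothesis
    [(k - 1) * #|B| <= #|A|] says that these [k * #|A|] lines can also do nearly
    all the work on the second axis: reserve [k - 1] elements of [A] for each [t]
    in [B], all reserved elements being distinct, and tilt one of the [k]
    vertical lines through each reserved [s] so that it passes through [(0, t)].
    Adding one horizontal line through each [t] gives [(0, t)] its last line, and
    gives the points off the axes back the vertical line that was tilted away
    ([optimal_cover], [optimal_cover_covers]).

    Lower bound: let [q_t], in [F[x]], be the product of the equations
    [a x + b y - c] of the covering lines, restricted to [y = t], and put
    [Q = prod_(s in A) (x - s)^k] and [P = x Q], of degree [k * #|A| + 1].  For
    [t] in [B] the covering condition makes [P] divide [q_t]; for [t = 0] it makes
    [Q] divide [q_0], while [q_0(0)] is nonzero because all lines miss the origin.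
    Let [phi] send a polynomial to the coefficient of [x^(k * #|A|)] in its
    remainder modulo [P].  Then [phi q_t] vanishes on [B] but not at [t = 0].
    On the other hand [x^i] comes with a polynomial in [t] of degree at most
    [d - i], where [d] is the number of lines, and [phi] kills all [x^i] with
    [i < k * #|A|]; hence [phi q_t] is a polynomial in [t] of degree at most
    [d - k * #|A|] ([functional_slice_poly]).  It is nonzero with [#|B|] roots, so
    [d >= k * #|A| + #|B|] ([grid_cover_size_ge]).  This is the two-dimensional
    case, for products of lines, of the punctured Nullstellensatz with
    multiplicity; [phi] is the residue functional at infinity. *)

(** * Lines and their equations *)

Definition line (R : nzRingType) (e : R * R * R) : set (R * R) :=
  [set p | e.1.1 * p.1 + e.1.2 * p.2 = e.2]%classic.

Lemma mem_line (R : nzRingType) (e : R * R * R) (p : R * R) :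
  (p \in line e) = (e.1.1 * p.1 + e.1.2 * p.2 == e.2).
Proof. by apply/idP/eqP => [/set_mem|/mem_set]. Qed.

Lemma is_lineE (R : realType) (s : seq (set (R * R))) :
  (forall L, L \in s -> is_line L) -> exists E : seq (R * R * R), s = map (@line R) E.
Proof.
elim: s => [|L s IH] sP; first by exists [::].
have [E ->] : exists E, s = map (@line R) E.
  by apply: IH => M Ms; apply: sP; rewrite inE Ms orbT.
have [a [b [c [_ ->]]]] := sP L (mem_head _ _).
by exists ((a, b, c) :: E).
Qed.

(** * The lower bound *)

Section LowerBound.
Variable F : fieldType.
Implicit Types (a b c s t : F) (E : seq (F * F * F)) (p q : {poly F}).

(** The bivariate polynomial that vanishes on the lines [E] enters only through
    its restrictions to horizontal lines, one polynomial in [x] for each [t]. *)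
Definition slice E t : {poly F} :=
  \prod_(e <- E) (e.1.1 *: 'X + (e.1.2 * t - e.2)%:P).

(** A line through [(s, t)] restricts to a multiple of [X - s] on [y = t]; this
    multiple is zero when the line is [y = t] itself. *)
Lemma slice_multiplicity E s t :
  ('X - s%:P) ^+ count (fun e => e.1.1 * s + e.1.2 * t == e.2) E %| slice E t.
Proof.
rewrite /slice; elim: E => [|e E IH]; first by rewrite big_nil expr0 dvdpp.
rewrite big_cons /=; case: eqP => [es|_]; last by rewrite add0n dvdp_mull.
rewrite exprD expr1 dvdp_mul // (_ : _ + _ = e.1.1 *: ('X - s%:P)).
  by rewrite -mul_polyC dvdp_mulIr.
by rewrite -es -!mul_polyC !(polyCB, polyCD, polyCM); ring.
Qed.

Lemma dvdp_prod_XsubC_exp (S : seq F) k q :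
  uniq S -> (forall s, s \in S -> ('X - s%:P) ^+ k %| q) ->
  \prod_(s <- S) ('X - s%:P) ^+ k %| q.
Proof.
elim: S => [|s S IH] /=; first by rewrite big_nil dvd1p.
move=> /andP[sS uS] Sq; rewrite big_cons Gauss_dvdp.
  rewrite Sq ?mem_head //= IH // => r rS.
  by rewrite Sq // inE rS orbT.
apply: coprimep_expl; rewrite coprimep_sym coprimep_XsubC /root horner_prod.
rewrite prodf_seq_neq0; apply/allP => r rS; rewrite /= !hornerE expf_eq0 negb_and.
by apply/orP; right; rewrite subr_eq0; apply: contraNneq sS => ->.
Qed.

(** The trade-off between degrees in the two variables: a functional that sees
    only terms of degree at least [N] in [x] leaves at most [size E - N] for the
    degree in [t].  Removing a line [a x + b t - c] from the product replaces
    [phi] either by [p |-> phi ('X * p)], which kills degrees below [N - 1] only,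
    or by [phi] times a factor of degree one in [t]; this is why the induction on
    [E] quantifies over [phi] and [N].  The bound is a truncated subtraction, so
    that it says [h = 0] when [size E < N]. *)
Lemma functional_slice_poly E N (phi : {poly F} -> F) :
  (forall c p q, phi (c *: p + q) = c * phi p + phi q) ->
  (forall p, (size p <= N)%N -> phi p = 0) ->
  exists2 h : {poly F}, (size h <= (size E).+1 - N)%N &
    forall t, h.[t] = phi (slice E t).
Proof.
elim: E N phi => [|[[a b] c] E IH] N phi phi_lin phiN.
  exists (phi 1)%:P; last by move=> t; rewrite hornerC /slice big_nil.
  rewrite size_polyC; case: N phiN => [|N] phiN; first by case: eqP.
  by rewrite phiN ?size_poly1 // eqxx.
have [h1 sz1 h1E] : exists2 h1 : {poly F}, (size h1 <= (size E).+1 - N.-1)%N &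
    forall t, h1.[t] = phi ('X * slice E t).
  apply: (IH _ (fun p => phi ('X * p))) => [d p q|p sp].
    by rewrite mulrDr -scalerAr phi_lin.
  have [-> | p0] := eqVneq p 0; first by rewrite mulr0 phiN ?size_poly0.
  apply: phiN; rewrite mulrC size_mulX //.
  by move: sp p0; rewrite -size_poly_eq0; lia.
have [h2 sz2 h2E] := IH N phi phi_lin phiN.
exists (a *: h1 + (b *: 'X - c%:P) * h2).
  apply: leq_trans (size_polyD _ _) _; rewrite geq_max; apply/andP; split.
    by apply: leq_trans (leq_trans (size_scale_leq _ _) sz1) _ => /=; lia.
  have [-> | h20] := eqVneq h2 0; first by rewrite mulr0 size_poly0.
  apply: leq_trans (size_polyMleq _ _) _.
  have : (size (b *: 'X - c%:P)%R <= 2)%N.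
    apply: leq_trans (size_polyD _ _) _; rewrite geq_max size_polyN.
    apply/andP; split; last by rewrite size_polyC; case: eqP.
    by apply: leq_trans (size_scale_leq _ _) _; rewrite size_polyX.
  by move: sz2 h20; rewrite -size_poly_eq0 /=; lia.
have phi0 : phi 0 = 0 by rewrite phiN ?size_poly0.
move=> t; have -> : slice ((a, b, c) :: E) t =
    a *: ('X * slice E t) + ((b * t - c) *: slice E t + 0).
  by rewrite /slice big_cons /= -!mul_polyC addr0; ring.
by rewrite !phi_lin phi0 addr0 !hornerE h1E h2E.
Qed.

End LowerBound.

(** [A] and [B] list the nonzero coordinates of the grid.  The polynomial in [t]
    attached to the top coefficient modulo [P] has [size B] roots and is nonzero
    at [0]; its degree, at most [size E - k * size A], is thus at least [size B]. *)
Lemma grid_cover_size_ge (F : fieldType) (A B : seq F) (k : nat) (E : seq (F * F * F)) :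
  uniq (0 :: A) -> uniq (0 :: B) -> (0 < k)%N ->
  {in E, forall e, e.2 != 0} ->
  (forall s t : F, s \in 0 :: A -> t \in 0 :: B -> (s, t) != (0, 0) ->
     (k <= count (fun e => e.1.1 * s + e.1.2 * t == e.2)%R E)%N) ->
  (k * size A + size B <= size E)%N.
Proof.
move=> uA uB k_gt0 E0 cover.
have dvd_slice s t : s \in 0 :: A -> t \in 0 :: B -> (s, t) != (0, 0) ->
    ('X - s%:P) ^+ k %| slice E t.
  move=> sA tB st0; apply: dvdp_trans (slice_multiplicity E s t).
  by apply: dvdp_exp2l; apply: cover.
pose Q : {poly F} := \prod_(s <- A) ('X - s%:P) ^+ k.
have dvdQ t : t \in 0 :: B -> Q %| slice E t.
  move=> tB; apply: dvdp_prod_XsubC_exp; first by case/andP: uA.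
  move=> s sA; apply: dvd_slice; rewrite ?inE ?sA ?orbT //.
  by rewrite xpair_eqE; case/andP: uA => A0 _; case: eqVneq sA A0 => // -> ->.
have Qmonic : Q \is monic by apply: monic_prod => s _; rewrite monic_exp ?monicXsubC.
have szQ : size Q = (k * size A).+1.
  rewrite /Q; elim: (A) => [|s S IH]; first by rewrite big_nil size_poly1 muln0.
  rewrite big_cons size_monicM ?monic_exp ?monicXsubC //.
    by rewrite IH size_exp_XsubC /=; lia.
  by rewrite -size_poly_eq0 IH.
have Q0 : Q.[0] != 0.
  rewrite horner_prod prodf_seq_neq0; apply/allP => s sA.
  rewrite /= !hornerE expf_eq0 negb_and oppr_eq0; apply/orP; right.
  by case/andP: uA => A0 _; apply: contraNneq A0 => <-.
pose P := Q * 'X.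
have szP : size P = (k * size A).+2 by rewrite size_mulX ?szQ // -size_poly_eq0 szQ.
pose phi p := (p %% P)`_(k * size A).
have phi_lin c p q : phi (c *: p + q) = c * phi p + phi q.
  by rewrite /phi modpD modpZl coefD coefZ.
have phi_small (p : {poly F}) : (size p <= k * size A)%N -> phi p = 0.
  move=> sp; rewrite /phi modp_small; first by rewrite nth_default.
  by rewrite szP ltnS leqW.
have [h szh hE] := functional_slice_poly E phi_lin phi_small.
(* For t in B, both coprime factors Q and 'X of P divide the slice. *)
have root_h : all (root h) B.
  apply/allP => t tB; have t0 : t != 0.
    by case/andP: uB => B0 _; apply: contraNneq B0 => <-.
  rewrite /root hE /phi (_ : _ %% P = 0) ?coef0 //; apply/eqP.
  rewrite -/(P %| _) Gauss_dvdp; last by rewrite -['X]subr0 coprimep_XsubC.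
  rewrite dvdQ ?inE ?tB ?orbT //=.
  apply: dvdp_trans (dvd_slice 0 t _ _ _); rewrite ?mem_head ?inE ?tB ?orbT //.
    by rewrite subr0 -{1}['X]expr1 dvdp_exp2l.
  by rewrite xpair_eqE negb_and t0 orbT.
(* Since Q is monic of degree k * size A and 'X divides u - u(0), the remainder
   of u * Q modulo P = Q * 'X is u(0) * Q, whose top coefficient is u(0). *)
have h0 : h.[0] != 0.
  have /dvdpP[u uE] := dvdQ 0 (mem_head _ _).
  have u0 : u.[0] != 0.
    have : (slice E 0).[0] != 0.
      rewrite horner_prod prodf_seq_neq0; apply/allP => e eE /=.
      by rewrite !hornerE ?mulr0 ?add0r oppr_eq0 E0.
    by rewrite uE hornerM; apply: contraNneq => ->; rewrite mul0r.
  have /dvdpP[v vE] : 'X %| u - u.[0]%:P.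
    by rewrite -['X]subr0 dvdp_XsubCl /root !hornerE subrr.
  have {}uE : slice E 0 = v * P + u.[0] *: Q.
    by rewrite uE -{1}[u](subrK u.[0]%:P) vE -mul_polyC /P; ring.
  rewrite hE /phi uE modpD modp_mull add0r modp_small; last first.
    by apply: leq_ltn_trans (size_scale_leq _ _) _; rewrite szQ szP.
  rewrite coefZ -[(k * size A)%N]/(k * size A).+1.-1 -szQ -lead_coefE.
  by rewrite (monicP Qmonic) mulr1.
rewrite leqNgt; apply/negP => small.
move: h0; rewrite (@roots_geq_poly_eq0 _ h B) ?horner0 ?eqxx //.
  by case/andP: uB.
by apply: leq_trans szh _; rewrite leq_subLR.
Qed.

(** * The upper bound *)

Section UpperBound.
Variable F : fieldType.
Implicit Types (s t : F) (A B : seq F).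

Definition repeat_each (T : Type) k (s : seq T) := flatten [seq nseq k x | x <- s].

Lemma size_repeat_each (T : Type) k (s : seq T) :
  size (repeat_each k s) = (k * size s)%N.
Proof. by elim: s => [|x s IH]; rewrite ?muln0 //= size_cat size_nseq IH mulnS. Qed.

Lemma count_repeat_each (T : Type) k (P : pred T) (s : seq T) :
  count P (repeat_each k s) = (k * count P s)%N.
Proof.
elim: s => [|x s IH]; first by rewrite muln0.
by rewrite /repeat_each /= count_cat -/(repeat_each k s) IH count_nseq /=; lia.
Qed.

Definition vertical s : F * F * F := (1, 0, s).
Definition horizontal t : F * F * F := (0, 1, t).
(** The line through [(st.1, 0)] and [(0, st.2)]. *)
Definition slanted (st : F * F) : F * F * F := (st.2, st.1, st.1 * st.2).

(** The first [k.-1 * size B] elements of [A] are the reserved ones: [zip] pairs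
    each of them with an element of [B] so that every [t] is used [k.-1] times.
    Every [s] keeps [k.-1] vertical lines, and the unreserved ones, listed by
    [drop], keep a [k]-th. *)
Definition optimal_cover k A B : seq (F * F * F) :=
  map slanted (zip (take (k.-1 * size B) A) (repeat_each k.-1 B)) ++
  map vertical (repeat_each k.-1 A ++ drop (k.-1 * size B) A) ++
  map horizontal B.

Lemma size_optimal_cover k A B :
  (0 < k)%N -> (k.-1 * size B <= size A)%N ->
  size (optimal_cover k A B) = (k * size A + size B)%N.
Proof.
move=> k0 AB; rewrite /optimal_cover !size_cat !size_map size_cat size_drop.
by rewrite size_zip !size_repeat_each size_takel // minnn; nia.
Qed.

(** The lines through [(s, t)] are counted separately in each of the four parts of
    the cover.  Off the axes, the vertical lines give [k.-1] and the horizontal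
    one completes them; on the second axis, the slanted lines play the part of
    the vertical ones; on the first axis, the [k]-th line is slanted or vertical
    according to whether [s] is reserved. *)
Lemma optimal_cover_covers k A B s t :
  (0 < k)%N -> (k.-1 * size B <= size A)%N ->
  s \in 0 :: A -> t \in 0 :: B -> (s, t) != (0, 0) ->
  (k <= count (fun e => e.1.1 * s + e.1.2 * t == e.2)%R (optimal_cover k A B))%N.
Proof.
move=> k0 AB sA tB st0; rewrite /optimal_cover !(count_cat, count_map).
set c1 := count _ (zip _ _); set c3 := count _ (repeat_each _ _).
set c4 := count _ (drop _ _); set c5 := count _ B.
have c5P : t \in B -> (0 < c5)%N.
  by move=> tB'; rewrite -has_count; apply/hasP; exists t; rewrite //= mul0r mul1r add0r.
have c3P : s \in A -> (k.-1 <= c3)%N.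
  move=> sA'; rewrite /c3 count_repeat_each leq_pmulr // -has_count.
  by apply/hasP; exists s; rewrite //= mul0r mul1r addr0.
have c1P0 : s = 0 -> t \in B -> (k.-1 <= c1)%N.
  move=> sE tB'.
  suff : (count_mem t (unzip2 (zip (take (k.-1 * size B) A) (repeat_each k.-1 B))) <= c1)%N.
    rewrite unzip2_zip ?size_repeat_each ?size_takel // count_repeat_each.
    apply: leq_trans.
    by rewrite leq_pmulr // -has_count has_pred1.
  rewrite count_map; apply: sub_count => -[a b] /= /eqP ->.
  by rewrite sE mulr0 add0r.
have c14P : t = 0 -> s \in A -> (0 < c1 + c4)%N.
  move=> tE; rewrite -{1}(cat_take_drop (k.-1 * size B) A) mem_cat.
  case/orP => [s_take|s_drop]; last first.
    rewrite addn_gt0; apply/orP; right; rewrite -has_count; apply/hasP.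
    by exists s; rewrite //= mul0r mul1r addr0.
  rewrite addn_gt0; apply/orP; left; rewrite -has_count; apply/hasP.
  have : s \in unzip1 (zip (take (k.-1 * size B) A) (repeat_each k.-1 B)).
    by rewrite unzip1_zip // size_repeat_each size_takel.
  case/mapP => -[a b] ab /= ->; exists (a, b) => //.
  by rewrite /= tE mulr0 addr0 mulrC.
move: st0 sA tB; rewrite xpair_eqE !inE.
have [s0|s0] /= := eqVneq s 0; have [t0|t0] //= := eqVneq t 0.
- by move=> _ _ tB; have := c1P0 s0 tB; have := c5P tB; lia.
- by move=> _ sA _; have := c14P t0 sA; have := c3P sA; lia.
- by move=> _ sA tB; have := c3P sA; have := c5P tB; lia.
Qed.

(** The two conditions say that the equations define lines, and that these avoid
    the origin. *)
Lemma optimal_cover_coef_neq0 k A B :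
  (k.-1 * size B <= size A)%N -> 0 \notin A -> 0 \notin B ->
  {in optimal_cover k A B, forall e, e.1 != (0, 0) /\ e.2 != 0}.
Proof.
move=> AB A0 B0; have subA s : s \in A -> s != 0 by apply: contraTneq => ->.
have subB t : t \in B -> t != 0 by apply: contraTneq => ->.
have rep j (C : seq F) x : x \in repeat_each j C -> x \in C.
  by case/flatten_mapP => y yC; rewrite mem_nseq => /andP[_ /eqP ->].
move=> e; rewrite /optimal_cover map_cat !mem_cat.
case/or3P => [/mapP[[s t] st ->]|/orP[]|] /=.
- have s0 : s != 0.
    apply/subA/(@mem_take (k.-1 * size B)).
    rewrite -(@unzip1_zip _ _ (take _ A) (repeat_each k.-1 B)).
      exact: (map_f fst st).
    by rewrite size_repeat_each size_takel.
  have t0 : t != 0.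
    apply/subB/(rep k.-1).
    rewrite -(@unzip2_zip _ _ (take (k.-1 * size B) A) (repeat_each k.-1 B)).
      exact: (map_f snd st).
    by rewrite size_repeat_each size_takel.
  by rewrite xpair_eqE negb_and t0 mulf_neq0.
- by case/mapP => s /rep sA -> /=; rewrite xpair_eqE oner_eq0 (subA s).
- by case/mapP => s /mem_drop sA -> /=; rewrite xpair_eqE oner_eq0 (subA s).
- by case/mapP => t tB -> /=; rewrite xpair_eqE oner_eq0 andbF (subB t).
Qed.

End UpperBound.

(** * The covering number *)

Theorem theorem1p1 (R : realType) (S1 S2 : {fset R}) (n m k : nat)
  (hn : #|` S1| = n) (hm : #|` S2| = m)
  (h1 : 0 \in S1) (h2 : 0 \in S2) (hk : (0 < k)%N)
  (hnm : ((k - 1) * (m - 1) + 1 <= n)%N) :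
  cov k (S1 `*` S2)%fset = (k * (n - 1) + (m - 1))%N.
Proof.
pose A : seq R := (S1 `\ 0)%fset; pose B : seq R := (S2 `\ 0)%fset.
have nE : (n - 1)%N = size A by rewrite -hn (cardfsD1 0) h1 addKn.
have mE : (m - 1)%N = size B by rewrite -hm (cardfsD1 0) h2 addKn.
have inA s : (s \in S1) = (s \in 0 :: A).
  by rewrite inE !inE; case: eqVneq => [->|].
have inB t : (t \in S2) = (t \in 0 :: B).
  by rewrite inE !inE; case: eqVneq => [->|].
have A0 : 0 \notin A by rewrite !inE eqxx.
have B0 : 0 \notin B by rewrite !inE eqxx.
rewrite /cov nE mE; case: ex_minnP => N /asboolP[H [[Hlines Hcover Havoid] szH]] Nmin.
have AB : (k.-1 * size B <= size A)%N by rewrite -nE -mE; lia.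
apply/eqP; rewrite eqn_leq; apply/andP; split.
- apply: Nmin; apply/asboolP.
  pose L := map (@line R) (optimal_cover k A B).
  exists (seq_mset L); split.
    split=> [M|[s t]|M].
    + rewrite (perm_mem (perm_eq_seq_mset _)) => /mapP[[[a b] c] eL ->].
      by exists a, b, c; have [] := optimal_cover_coef_neq0 AB A0 B0 eL.
    + rewrite in_fsetM inA inB => /andP[/= sA tB] st0.
      rewrite (permP (perm_eq_seq_mset _)) count_map.
      apply: leq_trans (optimal_cover_covers hk AB sA tB st0) _.
      by apply: sub_count => e /=; rewrite mem_line.
    rewrite (perm_mem (perm_eq_seq_mset _)) => /mapP[e eL ->].
    have [_ e0] := optimal_cover_coef_neq0 AB A0 B0 eL.
    by rewrite mem_line !mulr0 addr0 eq_sym.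
  by rewrite (perm_size (perm_eq_seq_mset _)) size_map size_optimal_cover.
- have [E HE] := is_lineE Hlines.
  rewrite -szH HE size_map; apply: grid_cover_size_ge => //.
  + by rewrite /= A0 fset_uniq.
  + by rewrite /= B0 fset_uniq.
  + move=> e eE; have /Havoid : line e \in H.
      by rewrite -[_ \in H]/(_ \in (H : seq _)) HE map_f.
    by rewrite mem_line !mulr0 addr0 eq_sym.
  + move=> s t sA tB st0.
    have stG : (s, t) \in (S1 `*` S2)%fset by rewrite in_fsetM inA inB sA tB.
    apply: leq_trans (Hcover _ stG st0) _; rewrite HE count_map.
    by apply: sub_count => e /=; rewrite mem_line.
Qed.
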